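(* For $p\in\{11,12,21\}$ let $F_p(x,y,z)$ be the trivariate generating function in which the coefficient of $x^ny^kz^t$ ($n\ge0$, $k\ge1$, $t\ge0$) is the number of $k$-ary faro words of length $n$ containing exactly $t$ occurrences of the consecutive pattern $p$. Then $$F_{11}(x,y,z)=\frac{2y(xz-x-1)}{-xyz+xy+x^3z-x^3+y-x^2+xz+x-1+(xz-x-1)A_1},$$ $$F_{21}(x,y,z)=\frac{2y}{-y+x^2z-2x+1+A_2},$$ $$F_{12}(x,y,z)=\frac{y\left(x^3z^2-x^3z+x^2z+xyz-xy-3xz+x+y-1+(xz-x+1)A_2\right)}{\left(x^3z^2-x^3z+x^2z-xyz+xy-xz-x-y+1+(xz-x+1)A_2\right)(-1+y)\,z}+\frac{y}{1-y},$$ where $A_1=\sqrt{x^4-2x^2y-2x^2+y^2-2y+1}$ and $A_2=\sqrt{x^4z^2-2x^2yz-2x^2z+y^2-2y+1}$.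
   Context: A $k$-ary word is a word over $\{1,\dots,k\}$. A $k$-ary faro word of length $n$ is a word $u_1v_1u_2v_2u_3v_3\cdots$ of length $n=|u|+|v|$ obtained by interlacing two nondecreasing $k$-ary words $u,v$ with $0\le |u|-|v|\le 1$ (equivalently, $w_i\le w_{i+2}$ for all $1\le i\le n-2$). The empty word is a $k$-ary faro word of length $0$ for every $k\ge1$. Occurrences of $11$, $12$, $21$ in a word $w$ are indices $i$ with $w_i=w_{i+1}$, $w_i<w_{i+1}$, $w_i>w_{i+1}$, respectively. Generating functions are formal power series, and square roots denote the branch with constant term $1$. *)

(* Defs.v *)
From HB Require Import structures.
From mathcomp Require Import all_boot all_order all_algebra.
From mathcomp Require Import boolp classical_sets.

Set Implicit Arguments.
Unset Strict Implicit.
Unset Printing Implicit Defensive.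

Import GRing.Theory.
Local Open Scope ring_scope.

(* Formal power series in one variable; the multivariate rings are obtained
   by iteration. *)
Record fps (R : Type) := Fps { fps_coef :> nat -> R }.

Notation "{ 'fps' R }" := (fps R) (format "{ 'fps'  R }") : type_scope.

HB.instance Definition _ (R : Type) := gen_eqMixin {fps R}.
HB.instance Definition _ (R : Type) := gen_choiceMixin {fps R}.

Lemma fpsP (R : Type) (f g : {fps R}) : f =1 g <-> f = g.
Proof.
split=> [|->//]; case: f g => [f] [g] /= fg.
by congr Fps; apply/funext.
Qed.

Section FpsRing.
Variable R : comNzRingType.
Implicit Types f g h : {fps R}.

Definition fps_zero : {fps R} := Fps (fun=> 0).
Definition fps_opp f : {fps R} := Fps (fun n => - f n).
Definition fps_add f g : {fps R} := Fps (fun n => f n + g n).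

Fact fps_addA : associative fps_add.
Proof. by move=> f g h; apply/fpsP => n /=; rewrite addrA. Qed.
Fact fps_addC : commutative fps_add.
Proof. by move=> f g; apply/fpsP => n /=; rewrite addrC. Qed.
Fact fps_add0 : left_id fps_zero fps_add.
Proof. by move=> f; apply/fpsP => n /=; rewrite add0r. Qed.
Fact fps_addN : left_inverse fps_zero fps_opp fps_add.
Proof. by move=> f; apply/fpsP => n /=; rewrite addNr. Qed.

HB.instance Definition _ := GRing.isZmodule.Build {fps R}
  fps_addA fps_addC fps_add0 fps_addN.

Definition fpsC (c : R) : {fps R} := Fps (fun n => if n == 0%N then c else 0).
Definition fpsX : {fps R} := Fps (fun n => (n == 1%N)%:R).
Definition fps_mul f g : {fps R} :=
  Fps (fun n => \sum_(j < n.+1) f j * g (n - j)%N).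

Definition fps_trunc (m : nat) f : {poly R} := \poly_(i < m.+1) f i.

Lemma fps_truncM f g (n m : nat) : (n <= m)%N ->
  fps_mul f g n = (fps_trunc m f * fps_trunc m g)`_n.
Proof.
move=> nm; rewrite coefM /=; apply: eq_bigr => j _.
have le_jn : (j <= n)%N by rewrite -ltnS.
by rewrite !coef_poly !ltnS (leq_trans le_jn nm) (leq_trans (leq_subr _ _) nm).
Qed.

Fact fps_mulA : associative fps_mul.
Proof.
move=> f g h; apply/fpsP => n; rewrite !(fps_truncM _ _ (leqnn n)).
have -> : (fps_trunc n f * fps_trunc n (fps_mul g h))`_n =
          (fps_trunc n f * (fps_trunc n g * fps_trunc n h))`_n.
  rewrite !coefM; apply: eq_bigr => j _; congr (_ * _).
  by rewrite coef_poly ltnS leq_subr (fps_truncM _ _ (leq_subr _ _)).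
rewrite mulrA !coefM; apply: eq_bigr => j _; congr (_ * _).
by rewrite [RHS]coef_poly ltn_ord (@fps_truncM _ _ _ n) // -ltnS.
Qed.
Fact fps_mulC : commutative fps_mul.
Proof.
by move=> f g; apply/fpsP => n; rewrite !(fps_truncM _ _ (leqnn n)) mulrC.
Qed.
Fact fps_mul1 : left_id (fpsC 1) fps_mul.
Proof.
move=> f; apply/fpsP => n /=.
rewrite big_ord_recl /= mul1r subn0 big1 ?addr0 // => i _.
by rewrite mul0r.
Qed.
Fact fps_mulDl : left_distributive fps_mul fps_add.
Proof.
move=> f g h; apply/fpsP => n /=; rewrite -big_split /=.
by apply: eq_bigr => i _; rewrite mulrDl.
Qed.
Fact fps_1_neq0 : fpsC 1 != 0 :> {fps R}.
Proof.
by apply/eqP => /fpsP/(_ 0%N) /= /eqP; rewrite oner_eq0.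
Qed.

HB.instance Definition _ := GRing.Zmodule_isComNzRing.Build {fps R}
  fps_mulA fps_mulC fps_mul1 fps_mulDl fps_1_neq0.

Lemma fps_coef0 (n : nat) : (0 : {fps R}) n = 0.
Proof. by []. Qed.
Lemma fps_coef1 (n : nat) : (1 : {fps R}) n = (n == 0%N)%:R.
Proof. by case: n. Qed.
Lemma fps_coefN f (n : nat) : (- f) n = - f n.
Proof. by []. Qed.
Lemma fps_coefD f g (n : nat) : (f + g) n = f n + g n.
Proof. by []. Qed.
Lemma fps_coefM f g (n : nat) :
  (f * g) n = \sum_(j < n.+1) f j * g (n - j)%N.
Proof. by []. Qed.

End FpsRing.

Arguments fpsX {R}.

(* The sequence whose n-th term is [step] of the list of its first n terms. *)
Section Recursion.
Variables (T : Type) (step : seq T -> T).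

Definition rec_prefix (n : nat) : seq T :=
  iter n (fun s => rcons s (step s)) [::].
Definition rec_seq (n : nat) : T := step (rec_prefix n).

Lemma rec_prefixE (n : nat) : rec_prefix n = mkseq rec_seq n.
Proof.
elim: n => // n IHn.
by rewrite /rec_prefix iterS -/(rec_prefix n) mkseqS /rec_seq {1}IHn.
Qed.

Lemma rec_seqE (n : nat) : rec_seq n = step (mkseq rec_seq n).
Proof. by rewrite /rec_seq rec_prefixE. Qed.

End Recursion.

Section FpsUnit.
Variable R : comUnitRingType.
Implicit Types f g h : {fps R}.

Definition fps_unit : pred {fps R} := fun f => f 0%N \is a GRing.unit.

Definition fps_inv_step f (s : seq R) : R :=
  (f 0%N)^-1 * ((size s == 0)%N%:R - \sum_(i < size s) s`_i * f (size s - i)%N).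

Definition fps_inv f : {fps R} :=
  if fps_unit f then Fps (rec_seq (fps_inv_step f)) else f.

Fact fps_mulVf : {in fps_unit, left_inverse 1 fps_inv *%R}.
Proof.
move=> f; rewrite /fps_inv /in_mem /= => uf; rewrite uf; apply/fpsP => n.
rewrite fps_coefM fps_coef1 big_ord_recr /= subnn rec_seqE /fps_inv_step.
rewrite size_mkseq mulrC mulrA divrr // mul1r.
set S1 := (X in X + _); set S2 := (X in _ - X).
suff -> : S1 = S2 by rewrite addrC subrK.
by apply: eq_bigr => i _; rewrite nth_mkseq.
Qed.

Fact fps_unitPl f g : g * f = 1 -> fps_unit f.
Proof.
move=> /fpsP/(_ 0%N); rewrite fps_coefM big_ord1 fps_coef1 => gf.
by apply/unitrPr; exists (g 0%N); rewrite mulrC.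
Qed.

Fact fps_inv_out : {in [predC fps_unit], fps_inv =1 id}.
Proof. by move=> f; rewrite inE /fps_inv /in_mem /= => /negbTE ->. Qed.

HB.instance Definition _ := GRing.ComNzRing_hasMulInverse.Build {fps R}
  fps_mulVf fps_unitPl fps_inv_out.

End FpsUnit.

Section FpsIdomain.
Variable R : idomainType.

Fact fps_mulf_eq0 : GRing.integral_domain_axiom {fps R}.
Proof.
have nz (f : {fps R}) : f != 0 -> exists n, f n != 0.
  move=> /eqP f0; apply: contrapT => nf; apply: f0; apply/fpsP => n.
  by apply/eqP/negPn/negP => fn; apply: nf; exists n.
move=> f g fg; apply/norP => -[/nz Hf /nz Hg].
case: (ex_minnP Hf) => n fn minf; case: (ex_minnP Hg) => m gm ming.
have lt_n : (n < (n + m).+1)%N by rewrite ltnS leq_addr.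
have : (f * g) (n + m)%N = 0 by rewrite fg.
rewrite fps_coefM (bigD1 (Ordinal lt_n)) //= addKn big1 => [|i ni].
  by move/eqP; rewrite addr0 mulf_eq0 (negbTE fn) (negbTE gm).
have [fi0|/minf le_ni] := eqVneq (f i) 0; first by rewrite fi0 mul0r.
have [gi0|/ming le_m] := eqVneq (g (n + m - i)%N) 0; first by rewrite gi0 mulr0.
have lt_ni : (n < i)%N by rewrite ltn_neqAle le_ni andbT eq_sym.
have := leq_add lt_ni le_m; rewrite addSn subnKC; last by rewrite -ltnS.
by rewrite ltnn.
Qed.

HB.instance Definition _ :=
  GRing.ComUnitRing_isIntegral.Build {fps R} fps_mulf_eq0.

End FpsIdomain.

Section FpsSqrt.
Variable R : comUnitRingType.

Definition fps_sqrt_step (b : R) (f : {fps R}) (s : seq R) : R :=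
  if s is b' :: s' then
    (f (size s) - \sum_(i < size s') s'`_i * s'`_(size s' - i.+1)%N) / (b *+ 2)
  else b.

Lemma fps_sqrt_exists (b : R) (f : {fps R}) :
    b \is a GRing.unit -> (2%:R : R) \is a GRing.unit -> b ^+ 2 = f 0%N ->
  exists g : {fps R}, g ^+ 2 = f /\ g 0%N = b.
Proof.
move=> ub u2 bf; pose r := rec_seq (fps_sqrt_step b f).
have r0 : r 0%N = b by [].
exists (Fps r); split; last by [].
apply/fpsP => n; rewrite expr2 fps_coefM /=.
case: n => [|n]; first by rewrite big_ord1 subnn r0 -expr2.
rewrite big_ord_recl big_ord_recr /= subn0 subnn r0.
have rS : r n.+1 = (f n.+1
    - \sum_(i < n) r i.+1 * r (n - i)%N) / (b *+ 2).
  rewrite /r rec_seqE /fps_sqrt_step /mkseq /= size_map size_iota.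
  congr ((_ - _) / _); apply: eq_bigr => i _.
  rewrite !(nth_map 0%N) ?size_iota ?nth_iota ?add1n //.
  - by rewrite subnSK.
  - by rewrite ltn_subrL /= (leq_ltn_trans _ (ltn_ord i)).
  - by rewrite ltn_subrL /= (leq_ltn_trans _ (ltn_ord i)).
rewrite rS; set S1 := (X in _ + (X + _)); set S2 := (X in _ - X).
have -> : S1 = S2 by apply: eq_bigr => i _; rewrite /bump /= add1n subSS.
rewrite addrCA (mulrC _ b) -mulr2n -mulrnAl mulrC divrK ?subrKC //.
by rewrite -mulr_natl unitrM u2.
Qed.

End FpsSqrt.

(* Q[[x, y, z]], realized as Q[[z]][[y]][[x]]: [f n k t] is the coefficient of
   x^n y^k z^t. *)
Notation Qxyz := {fps {fps {fps rat}}}.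

Definition ps_x : Qxyz := fpsX.
Definition ps_y : Qxyz := fpsC fpsX.
Definition ps_z : Qxyz := fpsC (fpsC fpsX).

Definition genfun3 (c : nat -> nat -> nat -> rat) : Qxyz :=
  Fps (fun n => Fps (fun k => Fps (fun t => c n k t))).

(* Meaningful only when [f] has constant term 1; see [ps_sqrtP]. *)
Definition ps_sqrt (f : Qxyz) : Qxyz :=
  xget 0 [set g : Qxyz | g ^+ 2 = f /\ g 0%N 0%N 0%N = 1].

Lemma ps_sqrtP (f : Qxyz) : f 0%N 0%N 0%N = 1 ->
  ps_sqrt f ^+ 2 = f /\ ps_sqrt f 0%N 0%N 0%N = 1.
Proof.
move=> f0.
have u2 : (2%:R : {fps {fps rat}}) \is a GRing.unit by [].
have [g1 [g1f g10]] : exists g : {fps rat}, g ^+ 2 = f 0%N 0%N /\ g 0%N = 1.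
  by apply: fps_sqrt_exists; rewrite ?unitr1 // expr1n.
have [g2 [g2f g20]] :
    exists g : {fps {fps rat}}, g ^+ 2 = f 0%N /\ g 0%N = g1.
  by apply: fps_sqrt_exists => //; rewrite unfold_in /= /fps_unit g10 unitr1.
have [g3 [g3f g30]] : exists g : Qxyz, g ^+ 2 = f /\ g 0%N = g2.
  apply: fps_sqrt_exists => //.
  by rewrite unfold_in /= /fps_unit unfold_in /= /fps_unit g20 g10 unitr1.
rewrite /ps_sqrt; case: xgetP => [g _ //|/(_ g3)] []; split=> //.
by rewrite g30 g20 g10.
Qed.

Lemma ps_sqrt_unique (f g : Qxyz) :
  g ^+ 2 = f -> g 0%N 0%N 0%N = 1 -> ps_sqrt f = g.
Proof.
move=> gf g0; have f0 : f 0%N 0%N 0%N = 1.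
  by rewrite -gf expr2 !fps_coefM !big_ord1 !subnn fps_coefM big_ord1 subnn
    fps_coefM big_ord1 g0 mulr1.
have [sf s0] := ps_sqrtP f0.
have /eqP : ps_sqrt f ^+ 2 = g ^+ 2 by rewrite sf gf.
rewrite eqf_sqr => /orP[/eqP //|/eqP sg].
by move: s0; rewrite sg !fps_coefN g0.
Qed.

Definition kary (k : nat) (w : seq nat) : bool := all (fun a => 1 <= a <= k)%N w.

(* u1 v1 u2 v2 ..., for [u] as long as [v] or longer by one letter. *)
Fixpoint interlace (u v : seq nat) : seq nat :=
  match u, v with
  | a :: u', b :: v' => a :: b :: interlace u' v'
  | _, _ => u
  end.

Definition kary_faro (k : nat) (w : seq nat) : Prop :=
  exists u v : seq nat,
    [/\ kary k u /\ kary k v,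
        sorted leq u /\ sorted leq v,
        (size v <= size u <= (size v).+1)%N
      & w = interlace u v].

(* The patterns 11, 12 and 21 are given by the order relation between the two
   consecutive letters. *)
Definition pat11 : rel nat := fun a b => a == b.
Definition pat12 : rel nat := fun a b => (a < b)%N.
Definition pat21 : rel nat := fun a b => (a > b)%N.

Definition occ (p : rel nat) (w : seq nat) : nat :=
  count (fun ab => p ab.1 ab.2) (zip w (behead w)).

(* The ambient type has letters 0, ..., k; [kary_faro k] excludes 0. *)
Definition faro_count (p : rel nat) (n k t : nat) : nat :=
  #|[set w : n.-tuple 'I_k.+1 |
      let s := [seq val i | i <- w] in `[< kary_faro k s >] && (occ p s == t)]|.

(* The sum over k starts at 1: the empty word over the empty alphabet is not
   counted. *)
Definition faro_gf (p : rel nat) : Qxyz :=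
  genfun3 (fun n k t => if (0 < k)%N then (faro_count p n k t)%:R else 0).

(* Main.v *)
Require Import Defs.
From mathcomp Require Import all_boot all_order all_algebra.
From mathcomp Require Import boolp.
From mathcomp Require Import ring.

(** A faro word is a word with [w_i <= w_(i+2)] for all [i] ([is_faroP]), so
    which letters may follow depends only on the last two.  Give each pair of
    adjacent letters the weight [asc], [flat] or [desc] according to its order;
    the three generating functions are the cases in which one of these weights
    is [z] and the other two are [1].

    Record a letter [c] of [{1, ..., k}] by its distance [k - c] to the largest
    letter.  The condition on successive letters [i, j, l] becomes [l <= i], the
    bound [k] disappears, and the total weight of the ways to add [n] letters after
    [i, j] is a number [ext_weight n i j] independent of [k].  Comparing the
    index [i] with [i - 1] leaves one new summand, [l = i]:
      C(i, j) = C(i - 1, j) + x * pair_weight i j * C(j, i),   C(-1, j) = 1,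
    where [C(i, j)] is the series in [x] with coefficients [ext_weight n i j].

    This recurrence is solved along diagonals.  With [y] marking [min i j], let
    [below d] collect the [C(i, i + d)] for [d > 0], and [above d] the
    [C(j + d, j)] for [d >= 0].  Then
      below d - y * below (d + 1) = 1 + x * asc * above d      (d > 0),
      above d - above (d - 1)     = x * desc * below d         (d > 0),
    with a similar equation for [above 0].  The solution is geometric,
    [below d = tau * rho ^ d] for [d > 0], where
      (1 - y * rho) * (rho - 1) = x ^ 2 * asc * desc * rho.
    The discriminant of this quadratic equation is the radicand of [A1] or
    [A2]: this is where the square roots come from.  Since the recurrence
    determines [C], it is enough to check the solution, and
    [D = above 0 = sum of y ^ i * C(i, i)] satisfies
      D * ((1 - x * flat) * (1 - y * rho) - x * asc * (y * rho)) = 1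
    ([diag_gfE]).

    A nonempty word over [{1, ..., k}] extends a virtual smallest letter
    followed by its actual first letter, so such words are counted by the sum
    over [j < k] of the [C(k - 1, j)].  Up to the factor [asc], and except for
    the weight of one summand, this is the sum that defines [C(k - 1, k - 1)],
    whence
      asc * F = y * (1 - x * flat + x * asc) * D + (asc - 1) * y / (1 - y)
    ([weight_gfE]).  Substituting the weights and clearing denominators gives
    the three formulas; for the pattern 12 one has [asc = z], which explains
    the division by [z] there. *)

Set Implicit Arguments.
Unset Strict Implicit.
Unset Printing Implicit Defensive.

Import GRing.Theory.
Local Open Scope ring_scope.

(** * Coefficients of power series *)

Section FpsCoefficients.
Variable R : comNzRingType.
Implicit Types (f g : {fps R}) (c : R) (n : nat).

Lemma fps_coefCM c f n : (fpsC c * f) n = c * f n.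
Proof.
rewrite fps_coefM big_ord_recl subn0 big1 ?addr0 // => i _.
by rewrite mul0r.
Qed.

Lemma fps_coefXM0 f : (fpsX * f) 0%N = 0.
Proof. by rewrite fps_coefM big_ord1 mul0r. Qed.

Lemma fps_coefXMS f n : (fpsX * f) n.+1 = f n.
Proof.
rewrite fps_coefM !big_ord_recl big1 => [|i _]; last by rewrite mul0r.
by rewrite mul0r mul1r subSS subn0 add0r addr0.
Qed.

Lemma fps_coefM0 f g : (f * g) 0%N = f 0%N * g 0%N.
Proof. by rewrite fps_coefM big_ord1. Qed.

Lemma fps_coefXn m n : ((fpsX : {fps R}) ^+ m) n = (m == n)%:R.
Proof.
elim: m n => [|m IHm] [|n]; rewrite ?fps_coef1 ?exprS ?fps_coefXM0 //.
by rewrite fps_coefXMS IHm.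
Qed.

Lemma fps_coef_sum (I : Type) (r : seq I) (P : pred I) (F : I -> {fps R}) n :
  (\sum_(i <- r | P i) F i) n = \sum_(i <- r | P i) F i n.
Proof. exact: (big_morph (fun f => fps_coef f n)). Qed.

End FpsCoefficients.

(** * Faro words *)

Fixpoint is_faro (w : seq nat) : bool :=
  if w is a :: ((_ :: c :: _) as w') then (a <= c)%N && is_faro w' else true.

Fixpoint unlace (w : seq nat) : seq nat * seq nat :=
  if w is a :: w' then (a :: (unlace w').2, (unlace w').1) else ([::], [::]).

(** Removing the first letter exchanges the roles of the two interlaced words;
    this symmetric form of the recursion gives inductions that remove one
    letter at a time. *)
Lemma interlace_cons (a : nat) (u v : seq nat) :
    (size v <= (size u).+1 <= (size v).+1)%N ->
  interlace (a :: u) v = a :: interlace v u.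
Proof.
elim: v a u => [|b v IHv] a [|c u] //=; rewrite !ltnS => s_uv.
  by case: v s_uv {IHv}.
by rewrite -(IHv c u).
Qed.

Lemma is_faroP (w : seq nat) :
  reflect (exists u v : seq nat, [/\ sorted leq u /\ sorted leq v,
     (size v <= size u <= (size v).+1)%N & w = interlace u v]) (is_faro w).
Proof.
apply: (iffP idP) => [w_faro | [u [v [[su sv] suv ->]]]].
  exists (unlace w).1, (unlace w).2.
  elim: w w_faro => [|a w IHw] //= w_faro.
  have /IHw[[su sv] suv w_eq] : is_faro w.
    by case: w w_faro {IHw} => [|b [|c w]] // /andP[].
  split; [split=> // | by rewrite ltnS; case/andP: suv => -> -> |].
    move: w_faro sv; case: (w) => [|b [|c w']] //= /andP[ac _].
    by rewrite ac.
  by rewrite {1}w_eq -interlace_cons // ltnS andbC.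
have [n] := ubnP (size u + size v)%N.
elim: n u v su sv suv => // n IHn [|a u] v su sv suv; first by case: v suv sv.
rewrite addSn ltnS => lt_n.
have suv' : (size u <= size v <= (size u).+1)%N by rewrite andbC; exact: suv.
rewrite interlace_cons; last by move: suv'; rewrite ltnS andbC.
have := IHn v u sv (path_sorted su) suv'; rewrite addnC => /(_ lt_n).
case: v sv suv suv' {lt_n IHn} => [|b v] //= sv suv suv'.
case: u su suv suv' => [|c u] /=; first by case: v {sv}.
by move=> /andP[-> _].
Qed.

(** Needed because the bound on the letters is imposed on the two parts of the
    word, and not on the word itself. *)
Lemma perm_interlace (u v : seq nat) :
    (size v <= size u <= (size v).+1)%N ->
  perm_eq (interlace u v) (u ++ v).
Proof.
elim: u v => [|a u IHu] [|b v] //= suv; first by case: u suv {IHu}.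
rewrite perm_cons -[b :: v]cat1s perm_sym perm_catCA /= perm_cons perm_sym.
exact: IHu.
Qed.

Lemma kary_faroE (k : nat) (w : seq nat) :
  `[< kary_faro k w >] = kary k w && is_faro w.
Proof.
apply/asboolP/andP => [[u [v [[ku kv] suv size_uv ->]]] | [kw /is_faroP]].
  split; last by apply/is_faroP; exists u, v.
  have: kary k (u ++ v) by rewrite /kary all_cat; apply/andP.
  by rewrite /kary (perm_all _ (perm_interlace size_uv)).
case=> u [v [suv size_uv w_eq]]; exists u, v; split=> //; apply/andP.
by rewrite -all_cat -(perm_all _ (perm_interlace size_uv)) -w_eq.
Qed.

(** * Weighted enumeration of faro words *)

Section Weights.
Variables (R : comNzRingType) (asc flat desc : R).

Definition pair_weight (a b : nat) : R :=
  if (a < b)%N then asc else if a == b then flat else desc.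

Definition word_weight (w : seq nat) : R :=
  \prod_(ab <- zip w (behead w)) pair_weight ab.1 ab.2.

Definition word_sum (k n : nat) (F : seq nat -> R) : R :=
  \sum_(w : n.-tuple 'I_k.+1) F [seq val i | i <- w].

Lemma word_sum0 (k : nat) (F : seq nat -> R) : word_sum k 0 F = F [::].
Proof.
rewrite /word_sum (bigD1 [tuple]) //= big1 ?addr0 // => w.
by rewrite (tuple0 w) => /eqP[]; apply: val_inj.
Qed.

Lemma word_sumS (k n : nat) (F : seq nat -> R) :
  word_sum k n.+1 F = \sum_(a < k.+1) word_sum k n (fun s => F (val a :: s)).
Proof.
rewrite /word_sum pair_big /=.
rewrite (reindex (fun p : 'I_k.+1 * n.-tuple 'I_k.+1 =>
  [tuple of p.1 :: p.2])) //=.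
exists (fun w => (thead w, [tuple of behead w])) => [[a w] _ | w _] /=.
  by congr pair; apply: val_inj.
by rewrite [RHS]tuple_eta.
Qed.

(** Letters are distances to the largest letter, so the order is reversed:
    [l] is the letter that follows [j], and [pair_weight l j] is the weight of
    that pair. *)
Fixpoint ext_weight (n i j : nat) : R :=
  if n is n'.+1 then \sum_(l < i.+1) pair_weight l j * ext_weight n' j l else 1.

Lemma pair_weight_compl (k a b : nat) : (a <= k)%N -> (b <= k)%N ->
  pair_weight (k - a) (k - b) = pair_weight b a.
Proof.
move=> ak bk; rewrite /pair_weight ltn_sub2lE // [(k - a == _)%N]eqn_sub2lE //.
by rewrite (eq_sym a b).
Qed.

Definition faro_weight (k : nat) (w : seq nat) : R :=
  if kary k w && is_faro w then word_weight w else 0.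

(** The next letter [c] must satisfy [a <= c <= k], that is, its distance
    [l = k - c] must satisfy [l <= k - a]: this is the summation range of
    [ext_weight]. *)
Lemma faro_continuations (k n a b : nat) :
    (0 < a <= k)%N -> (0 < b <= k)%N ->
  word_sum k n (fun s =>
    if kary k s && is_faro [:: a, b & s] then word_weight (b :: s) else 0)
  = ext_weight n (k - a) (k - b).
Proof.
elim: n a b => [|n IHn] a b ak bk.
  by rewrite word_sum0 /word_weight /= big_nil.
rewrite word_sumS /=.
have /andP[a0 lak] := ak.
have le1 : ((k - a).+1 <= k.+1)%N by rewrite /= ltnS leq_subr.
rewrite (big_ord_widen _
  (fun l => pair_weight l (k - b) * ext_weight n (k - b) l) le1).
rewrite (reindex_inj rev_ord_inj) [RHS]big_mkcond; apply: eq_bigr => l _ /=.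
have lk : (l <= k)%N by rewrite -ltnS.
rewrite subSS; have -> : (l < (k - a).+1)%N = (a <= k - l)%N.
  by rewrite ltnS !leq_subRL // addnC.
case: ifP => [alk|alk]; last first.
  by rewrite /word_sum big1 // => w _; rewrite andbF.
have ck : (0 < k - l <= k)%N by rewrite leq_subr (leq_trans a0 alk).
have -> : pair_weight l (k - b) = pair_weight b (k - l).
  have /andP[_ lbk] := bk.
  by rewrite -(pair_weight_compl (k := k)) ?leq_subr // subKn.
have -> : ext_weight n (k - b) l = ext_weight n (k - b) (k - (k - l)).
  by rewrite subKn.
rewrite -IHn // /word_sum mulr_sumr; apply: eq_bigr => w _.
rewrite ck /=; case: ifP => _; last by rewrite mulr0.
by rewrite /word_weight /= big_cons.
Qed.

Lemma faro_weight_sum0 (k : nat) : word_sum k 0 (faro_weight k) = 1.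
Proof. by rewrite word_sum0 /faro_weight /word_weight /= big_nil. Qed.

(** The letter [1] put in front of a word imposes no condition on it, so a
    nonempty word is a continuation of [1] and of its own first letter. *)
Lemma faro_weight_sumS (n k : nat) :
  word_sum k.+1 n.+1 (faro_weight k.+1) = \sum_(j < k.+1) ext_weight n k j.
Proof.
rewrite word_sumS big_ord_recl /= {1}/word_sum big1 ?add0r => [|w _]; last first.
  (* The summand for the letter 0, which no word may contain. *)
  by rewrite /faro_weight.
rewrite (reindex_inj rev_ord_inj); apply: eq_bigr => j _ /=.
have jk : (j <= k)%N by rewrite -ltnS.
have -> : bump 0 (k.+1 - j.+1) = (k - j).+1 by rewrite /bump subSS.
have ck : (0 < (k - j).+1 <= k.+1)%N by rewrite /= ltnS leq_subr.
have -> : ext_weight n k j = ext_weight n (k.+1 - 1) (k.+1 - (k - j).+1).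
  by rewrite subSS subn0 subSS subKn.
rewrite -faro_continuations // /word_sum; apply: eq_bigr => w _.
rewrite /faro_weight /= ltnS leq_subr /=.
case: {w}(map _ _) => [|c s] //=.
by case: (0 < c)%N; rewrite ?andbF.
Qed.

(** The ranges of summation at [i] and at [i - 1] differ by the single index
    [l = i]. *)
Lemma ext_weight_rec (n i j : nat) :
  ext_weight n i j = (if i is i'.+1 then ext_weight n i' j else (n == 0)%N%:R)
            + (if n is n'.+1 then pair_weight i j * ext_weight n' j i else 0).
Proof.
case: n i => [|n] [|i] /=; rewrite ?addr0 //.
  by rewrite big_ord1 add0r.
by rewrite big_ord_recr.
Qed.

(** On the diagonal all the summands of [ext_weight n.+1 i i] have the weight
    [asc], except the one with [l = i]. *)
Lemma ext_row_sum (n i : nat) :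
  asc * \sum_(j < i.+1) ext_weight n i j
    = ext_weight n.+1 i i + (asc - flat) * ext_weight n i i.
Proof.
have -> : ext_weight n.+1 i i =
    asc * (\sum_(j < i) ext_weight n i j) + flat * ext_weight n i i.
  rewrite /= big_ord_recr /= {2}/pair_weight ltnn eqxx mulr_sumr; congr (_ + _).
  by apply: eq_bigr => l _; rewrite /pair_weight ltn_ord.
by rewrite big_ord_recr /=; ring.
Qed.

End Weights.

(** * The recurrence along diagonals *)

Section DiagonalSeries.
Variables (R : comNzRingType) (asc flat desc : R).

Notation PS := {fps {fps R}}.
Let x : PS := fpsX.
Let y : PS := fpsC fpsX.
Let cst (c : R) : PS := fpsC (fpsC c).

Lemma coef_yM (f : PS) (n m : nat) :
  (y * f) n m = if m is m'.+1 then f n m' else 0.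
Proof.
by rewrite fps_coefCM; case: m => [|m]; rewrite ?fps_coefXM0 ?fps_coefXMS.
Qed.

Lemma coef_xcM (c : R) (f : PS) (n m : nat) :
  (x * (cst c * f)) n m = if n is n'.+1 then c * f n' m else 0.
Proof. by case: n => [|n]; rewrite ?fps_coefXM0 ?fps_coefXMS // !fps_coefCM. Qed.

Variables below above : nat -> PS.
Hypothesis below_rec : forall d,
  below d.+1 = y * below d.+2 + 1 + x * (cst asc * above d.+1).
Hypothesis above0 : above 0%N = y * below 1%N + 1 + x * (cst flat * above 0%N).
Hypothesis aboveS : forall d,
  above d.+1 = above d + x * (cst desc * below d.+1).

(* Double sequence whose diagonals are the series [below d] and [above d],
   with y marking the smaller index. *)
Let diag_coef (n i j : nat) : R :=
  if (i < j)%N then below (j - i)%N n i else above (i - j)%N n j.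

Lemma diag_coef_rec (n i j : nat) :
  diag_coef n i j = (if i is i'.+1 then diag_coef n i' j else (n == 0)%N%:R)
    + (if n is n'.+1 then pair_weight asc flat desc i j * diag_coef n' j i
       else 0).
Proof.
have coef1 m : (1 : PS) n m = ((n == 0) && (m == 0))%N%:R.
  by rewrite fps_coef1; case: n => //; rewrite fps_coef1.
rewrite /diag_coef /pair_weight; case: (ltngtP i j) => [ij | ji | ->].
- have [d ->] : exists d, j = (i + d.+1)%N.
    by exists (j - i.+1)%N; rewrite addnS -addSn subnKC.
  rewrite addKn below_rec !fps_coefD coef_yM coef1 coef_xcM; congr (_ + _).
  case: i {ij} => [|i] /=; first by rewrite add0r andbT.
  by rewrite andbF addr0 addSnnS addKn addnS ltnS leq_addr.
- have [d ->] : exists d, i = (j + d.+1)%N.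
    by exists (i - j.+1)%N; rewrite addnS -addSn subnKC.
  by rewrite addKn aboveS !fps_coefD coef_xcM addnS ltnNge leq_addr /= addKn.
rewrite subnn {1}above0 !fps_coefD coef_yM coef1 coef_xcM; congr (_ + _).
case: j => [|j] /=; first by rewrite add0r andbT.
by rewrite andbF addr0 ltnSn subSnn.
Qed.

(** [ext_weight] and [diag_coef] satisfy the same recurrence, which determines
    its solution by induction on the length, then on the row. *)
Lemma ext_weight_diag (n i : nat) :
  ext_weight asc flat desc n i i = above 0%N n i.
Proof.
have ext_weightE : forall j, ext_weight asc flat desc n i j = diag_coef n i j.
  elim: n i => [|n IHn] i; elim: i => [|i IHi] j;
    by rewrite ext_weight_rec diag_coef_rec ?IHi ?IHn.
by rewrite ext_weightE /diag_coef ltnn subnn.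
Qed.

End DiagonalSeries.

(** * Solution of the recurrence *)

Lemma fps_unitE (R : comUnitRingType) (f : {fps R}) :
  (f \is a GRing.unit) = (f 0%N \is a GRing.unit).
Proof. by []. Qed.

Section ClosedForm.
Variables (R : comUnitRingType) (asc flat desc : R).

Notation PS := {fps {fps R}}.
Let x : PS := fpsX.
Let y : PS := fpsC fpsX.
Let cst (c : R) : PS := fpsC (fpsC c).

Definition diag_gf : PS :=
  Fps (fun n => Fps (fun m => ext_weight asc flat desc n m m)).

Definition weight_gf : PS :=
  Fps (fun n => Fps (fun k =>
    if (0 < k)%N then word_sum k n (faro_weight asc flat desc k) else 0)).

Lemma cstM (c d : R) : cst (c * d) = cst c * cst d.
Proof.
apply/fpsP => n; rewrite /cst fps_coefCM; case: n => [|n] /=.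
  by apply/fpsP => m; rewrite fps_coefCM /=; case: m => //=; rewrite mulr0.
by rewrite mulr0.
Qed.

Lemma cstB (c d : R) : cst (c - d) = cst c - cst d.
Proof. by apply/fpsP => -[|n] //; apply/fpsP => -[|m] //=; rewrite subr0. Qed.

Lemma unit_of_const1 (f : PS) : f 0%N 0%N = 1 -> f \is a GRing.unit.
Proof. by move=> f1; rewrite !fps_unitE f1 unitr1. Qed.

(** Here the geometric solution is checked.  Its factor [tau] is chosen so that
    the relation [belowE] between the two families holds for [d = 0], and the
    equation of [rho] carries that relation from [d] to [d + 1].  At [d = 0] the
    diagonal itself is [above 0], not [below 0]. *)
Lemma diag_gfE (rho : PS) :
    (1 - y * rho) * (rho - 1) = x ^+ 2 * cst (asc * desc) * rho ->
  diag_gf * ((1 - x * cst flat) * (1 - y * rho) - x * cst asc * (y * rho)) = 1.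
Proof.
set a := cst asc; set b := cst flat; set c := cst desc.
rewrite cstM -/a -/c => rhoE.
set E := _ - _ * (y * rho).
have uE : E \is a GRing.unit.
  apply: unit_of_const1.
  rewrite /E !(fps_coefD, fps_coefN, fps_coefM0) /=.
  by rewrite !(mul0r, mulr0, subr0, mulr1).
have uy : 1 - y * rho \is a GRing.unit.
  apply: unit_of_const1.
  by rewrite !(fps_coefD, fps_coefN, fps_coefM0) /= mul0r subr0.
pose D := E^-1; have DE : D * E = 1 by rewrite mulVr.
pose tau := (1 + x * a * D) / (1 - y * rho).
have tauE : tau * (1 - y * rho) = 1 + x * a * D by rewrite divrK.
pose below d := tau * rho ^+ d.
pose above d := D + x * c * (\sum_(s < d) below s.+1).
suff -> : diag_gf = D by [].
apply/fpsP => n; apply/fpsP => i /=.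
have aboveS d : above d.+1 = above d + x * (c * below d.+1).
  by rewrite /above big_ord_recr /=; ring.
have above0 : above 0%N = D by rewrite /above big_ord0 mulr0 addr0.
have belowE d : below d * (1 - y * rho) = 1 + x * a * above d.
  elim: d => [|d IHd]; first by rewrite /below expr0 mulr1 above0.
  have -> : 1 + x * a * above d.+1 =
      1 + x * a * above d + x ^+ 2 * (a * c) * below d.+1.
    by rewrite aboveS; ring.
  rewrite -IHd /below exprS.
  have -> : tau * (rho * rho ^+ d) * (1 - y * rho) =
    tau * rho ^+ d * (1 - y * rho)
      + tau * rho ^+ d * ((1 - y * rho) * (rho - 1)) by ring.
  by rewrite rhoE; ring.
rewrite -above0; apply: (ext_weight_diag (below := below)).
- move=> d; apply: (addrI (- (y * below d.+2))).
  have -> : - (y * below d.+2) + below d.+1 = below d.+1 * (1 - y * rho).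
    by rewrite /below (exprS _ d.+1); ring.
  by rewrite belowE -/x -/y -/(cst _) -/a; ring.
- rewrite above0 /below expr1 -/x -/y -/(cst _) -/b; apply: (mulIr uy).
  have -> : (y * (tau * rho) + 1 + x * (b * D)) * (1 - y * rho) =
    y * rho * (tau * (1 - y * rho)) + (1 + x * b * D) * (1 - y * rho) by ring.
  rewrite tauE.
  have -> : D * (1 - y * rho) =
      y * rho * (1 + x * a * D) + (1 + x * b * D) * (1 - y * rho) + (D * E - 1).
    by rewrite /E; ring.
  by rewrite DE subrr addr0.
exact: aboveS.
Qed.

(** Multiplying by [asc] turns the unweighted sum over the first letter into
    the sum that defines the next diagonal coefficient ([ext_row_sum]); the term
    [(asc - 1) * y / (1 - y)] accounts for the empty words. *)
Lemma weight_gfE (Y : PS) : (1 - y) * Y = 1 ->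
  cst asc * weight_gf =
    y * ((1 - x * cst flat + x * cst asc) * diag_gf) + (cst asc - 1) * (y * Y).
Proof.
move=> yY.
pose G : PS := fpsC (Fps (fun=> 1)).
have -> : Y = G.
  (* G is the geometric series in y. *)
  suff GE : G = y * G + 1.
    apply: (@mulrI _ (1 - y)); last by rewrite yY mulrBl {1}GE; ring.
    by apply: unit_of_const1; rewrite !(fps_coefD, fps_coefN) /= subr0.
  apply/fpsP => n; apply/fpsP => k; rewrite !fps_coefD coef_yM.
  by rewrite fps_coef1; case: n k => [|n] [|k] //=;
    rewrite ?fps_coef1 ?fps_coef0 /= ?addr0 ?add0r.
have -> : y * ((1 - x * cst flat + x * cst asc) * diag_gf)
    + (cst asc - 1) * (y * G)
  = y * (diag_gf + x * (cst (asc - flat) * diag_gf) + cst (asc - 1) * G).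
  by rewrite !cstB -[cst 1]/(1 : PS); ring.
apply/fpsP => n; apply/fpsP => k.
rewrite coef_yM !fps_coefCM; case: k => [|k]; first exact: mulr0.
rewrite !fps_coefD coef_xcM !fps_coefCM ?fps_coefCM; case: n => [|n] /=.
  by rewrite faro_weight_sum0 !mulr1 addr0 addrC subrK.
by rewrite faro_weight_sumS ext_row_sum mulr0 addr0.
Qed.

End ClosedForm.

(** * Specialization to the three patterns *)

Lemma weight_occ (p : rel nat) (asc flat desc : {fps rat}) (w : seq nat) :
    (forall a b, pair_weight asc flat desc a b = if p a b then fpsX else 1) ->
  word_weight asc flat desc w = fpsX ^+ occ p w.
Proof.
move=> wtE; rewrite /word_weight /occ; elim: (zip _ _) => [|ab s IHs].
  by rewrite big_nil.
by rewrite big_cons IHs wtE /= exprD; case: (p _ _).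
Qed.

Lemma faro_gf_weight (p : rel nat) (asc flat desc : {fps rat}) :
    (forall a b, pair_weight asc flat desc a b = if p a b then fpsX else 1) ->
  faro_gf p = weight_gf asc flat desc.
Proof.
move=> wtE; apply/fpsP => n; apply/fpsP => k; apply/fpsP => t /=.
case: ltnP => // _; rewrite /word_sum fps_coef_sum /faro_count -sum1dep_card.
rewrite natr_sum big_mkcond; apply: eq_bigr => w _ /=.
rewrite /faro_weight kary_faroE; case: (kary k _ && is_faro _) => //=.
by rewrite (weight_occ _ wtE) fps_coefXn; case: eqP.
Qed.

(** [r] is the root with constant term [1] of [r ^ 2 - (1 + y - u) * r + y], the
    reversal of the quadratic equation for [rho].  Defining [rho] as [r^-1]
    avoids the division by [y] in the usual formula for the other root. *)
Lemma inverse_root (S : comUnitRingType) (y u A r rho : S) :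
    (2 : S) \is a GRing.unit -> A ^+ 2 = (1 + y - u) ^+ 2 - 4 * y ->
    2 * r = 1 + y - u + A -> r * rho = 1 ->
  (1 - y * rho) * (rho - 1) = u * rho /\ 1 + y - u - A = 2 * (y * rho).
Proof.
move=> u2 A2 rE rrho.
have rr : (1 + y - u - r) * r = y.
  apply: (mulrI u2); apply: (mulrI u2).
  have -> : 2 * (2 * ((1 + y - u - r) * r)) =
    (2 * (1 + y - u) - 2 * r) * (2 * r) by ring.
  rewrite rE.
  have -> : (2 * (1 + y - u) - (1 + y - u + A)) * (1 + y - u + A)
     = (1 + y - u) ^+ 2 - A ^+ 2 by ring.
  by rewrite A2; ring.
have yrho : y * rho = 1 + y - u - r by rewrite -{1}rr -mulrA rrho mulr1.
split; last by rewrite yrho mulrBr rE; ring.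
have -> : (1 - y * rho) * (rho - 1) =
  rho - 1 - y * rho * rho + y * rho by ring.
rewrite yrho.
have -> : rho - 1 - (1 + y - u - r) * rho + (1 + y - u - r)
   = u * rho - y * rho + (r * rho - 1) + (1 + y - u - r) by ring.
by rewrite yrho rrho; ring.
Qed.

Lemma diag_gf_sqrt (asc flat desc : {fps rat}) (A : Qxyz) :
  let a : Qxyz := fpsC (fpsC asc) in
  let b : Qxyz := fpsC (fpsC flat) in
  let u : Qxyz := ps_x ^+ 2 * fpsC (fpsC (asc * desc)) in
    A ^+ 2 = (1 + ps_y - u) ^+ 2 - 4 * ps_y -> A 0%N 0%N 0%N = 1 ->
  diag_gf asc flat desc
    * (2 * (1 - ps_x * b) - (1 + ps_y - u - A) * (1 - ps_x * b + ps_x * a)) = 2.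
Proof.
move=> a b u A2 A0.
have u2 : (2 : Qxyz) \is a GRing.unit by [].
pose r := (1 + ps_y - u + A) / 2.
have rE : 2 * r = 1 + ps_y - u + A by rewrite /r mulrC divrK.
have ur : r \is a GRing.unit.
  suff const2 : (2 * r) 0%N 0%N 0%N = 2.
    have: 2 * r \is a GRing.unit by rewrite !fps_unitE const2.
    by rewrite unitrM u2.
  have u0 : u 0%N = 0 by rewrite /u expr2 -!mulrA fps_coefXM0.
  by rewrite rE !(fps_coefD, fps_coefN) u0 A0.
pose rho := r^-1.
have rrho : r * rho = 1 by rewrite mulrV.
have [rhoE AE] := inverse_root u2 A2 rE rrho.
have DE : diag_gf asc flat desc *
    ((1 - ps_x * b) * (1 - ps_y * rho) - ps_x * a * (ps_y * rho)) = 1.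
  exact: diag_gfE rhoE.
rewrite AE.
have -> : 2 * (1 - ps_x * b) - 2 * (ps_y * rho) * (1 - ps_x * b + ps_x * a) =
    2 * ((1 - ps_x * b) * (1 - ps_y * rho) - ps_x * a * (ps_y * rho)) by ring.
by rewrite mulrCA DE mulr1.
Qed.

(** The radicand has constant term [1], so its square root is meaningful. *)
Lemma sqrt_discriminant (c : {fps rat}) (f : Qxyz) :
    f = (1 + ps_y - ps_x ^+ 2 * fpsC (fpsC c)) ^+ 2 - 4 * ps_y ->
  ps_sqrt f ^+ 2 = f /\ ps_sqrt f 0%N 0%N 0%N = 1.
Proof.
move=> ->; apply: ps_sqrtP.
rewrite !expr2 -!mulrA !(fps_coefD, fps_coefN, fps_coefM0) /=.
by rewrite !(mul0r, mulr0, subr0, addr0, mulr1).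
Qed.

(** The assumptions on [a], [b] and [c] let the constants [1] and [z] be
    substituted in their simplest form. *)
Lemma faro_gf_system (p : rel nat) (asc flat desc d : {fps rat})
    (a b c f : Qxyz) :
    (forall i j, pair_weight asc flat desc i j = if p i j then fpsX else 1) ->
    fpsC (fpsC asc) = a -> fpsC (fpsC flat) = b ->
    asc * desc = d -> fpsC (fpsC d) = c ->
    f = (1 + ps_y - ps_x ^+ 2 * c) ^+ 2 - 4 * ps_y ->
  exists D Y : Qxyz, [/\ (1 - ps_y) * Y = 1,
    D * (2 * (1 - ps_x * b)
         - (1 + ps_y - ps_x ^+ 2 * c - ps_sqrt f) * (1 - ps_x * b + ps_x * a))
      = 2
    & a * faro_gf p
      = ps_y * ((1 - ps_x * b + ps_x * a) * D) + (a - 1) * (ps_y * Y)].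
Proof.
move=> wtE <- <- <- <- fE.
have [A2 A0] := sqrt_discriminant fE.
have uy : (1 - ps_y : Qxyz) \is a GRing.unit.
  by apply: unit_of_const1; rewrite !(fps_coefD, fps_coefN) /= subr0.
rewrite {2}fE in A2.
exists (diag_gf asc flat desc), (1 - ps_y)^-1; split; first exact: mulrV.
  exact: (@diag_gf_sqrt asc flat desc _ A2 A0).
by rewrite (faro_gf_weight wtE); apply: weight_gfE; exact: mulrV.
Qed.

(** * Closed forms in the field of fractions *)

Local Notation "g %:F" := (tofrac g).

(** The passage to fractions is done over an arbitrary domain, since the
    identities are polynomial in the series involved.  That [E] is nonzero comes
    from [D * E = 2]. *)
Lemma fraction_system (R : idomainType) (x y a b c A D Y T : R) :
    (2 : R) != 0 -> (1 - y) * Y = 1 ->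
    D * (2 * (1 - x * b) - (1 + y - x ^+ 2 * c - A) * (1 - x * b + x * a)) = 2 ->
    a * T = y * ((1 - x * b + x * a) * D) + (a - 1) * (y * Y) ->
  exists E : {fraction R}, [/\ E = 2 * (1 - x%:F * b%:F)
    - (1 + y%:F - x%:F ^+ 2 * c%:F - A%:F) * (1 - x%:F * b%:F + x%:F * a%:F),
    E != 0, 1 - y%:F != 0
    & a%:F * T%:F = 2 * y%:F * (1 - x%:F * b%:F + x%:F * a%:F) / E
                  + (a%:F - 1) * (y%:F / (1 - y%:F))].
Proof.
move=> two0 /(congr1 (@tofrac R)) yY /(congr1 (@tofrac R)) DE.
move=> /(congr1 (@tofrac R)) TE.
have q2 : (2 : {fraction R}) != 0.
  have -> : (2 : {fraction R}) = 2%:F by rewrite rmorph_nat.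
  by rewrite tofrac_eq0.
move: yY DE TE; rewrite !(rmorph_nat, rmorphXn, rmorphM, rmorphB, rmorphD).
rewrite !rmorph1 /=; set E := (X in _ * X = 2) => yY DE TE.
have y1 : 1 - y%:F != 0.
  by apply: contra_eq_neq yY => ->; rewrite mul0r eq_sym oner_eq0.
have E0 : E != 0 by apply: contraNneq q2 => E0; rewrite -DE E0 mulr0.
exists E; split=> //; rewrite TE.
have -> : Y%:F = (1 - y%:F)^-1 by apply: (mulfI y1); rewrite yY mulfV.
have -> : D%:F = 2 / E by rewrite -DE mulfK.
by ring.
Qed.

Lemma partial_fractions (K : fieldType) (y z s E : K) :
    z != 0 -> 1 - y != 0 -> E != 0 ->
  2 * y * s / E + (z - 1) * (y / (1 - y)) =
  z * (y * (E + 2 * (y - 1) * s) / (E * (- 1 + y) * z) + y / (1 - y)).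
Proof.
move=> z0 y1 E0; have y1' : - 1 + y != 0 by rewrite addrC -opprB oppr_eq0.
by field; rewrite E0 y1 y1' z0.
Qed.

(** In the next three lemmas the factors [1] stand for weights that are not
    marked; they are written out to match [faro_gf_system]. *)
Section FractionForms.
Variables (R : idomainType) (x y z A D Y T : R).
Hypotheses (two0 : (2 : R) != 0) (yY : (1 - y) * Y = 1).

Lemma fraction_form11 :
    D * (2 * (1 - x * z) - (1 + y - x ^+ 2 * 1 - A) * (1 - x * z + x * 1)) = 2 ->
    1 * T = y * ((1 - x * z + x * 1) * D) + (1 - 1) * (y * Y) ->
  T%:F = (2 * y%:F * (x%:F * z%:F - x%:F - 1))
        / (- (x%:F * y%:F * z%:F) + x%:F * y%:F + x%:F ^+ 3 * z%:F - x%:F ^+ 3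
           + y%:F - x%:F ^+ 2 + x%:F * z%:F + x%:F - 1
           + (x%:F * z%:F - x%:F - 1) * A%:F).
Proof.
move=> DE /(fraction_system two0 yY DE); rewrite tofrac1.
move=> [E [EE _ _]]; rewrite mul1r subrr mul0r addr0 => ->.
(* Numerator and denominator both carry a minus sign. *)
set E' := (X in _ = _ / X); have -> : E' = - E by rewrite EE /E'; ring.
by rewrite invrN mulrN -mulNr; congr (_ / _); ring.
Qed.

Lemma fraction_form21 :
    D * (2 * (1 - x * 1) - (1 + y - x ^+ 2 * z - A) * (1 - x * 1 + x * 1)) = 2 ->
    1 * T = y * ((1 - x * 1 + x * 1) * D) + (1 - 1) * (y * Y) ->
  T%:F = (2 * y%:F) / (- y%:F + x%:F ^+ 2 * z%:F - 2 * x%:F + 1 + A%:F).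
Proof.
move=> DE /(fraction_system two0 yY DE); rewrite tofrac1.
move=> [E [EE _ _]]; rewrite mul1r subrr mul0r addr0 => ->.
set E' := (X in _ = _ / X); have -> : E' = E by rewrite EE /E'; ring.
by congr (_ / _); ring.
Qed.

Lemma fraction_form12 : z != 0 ->
    D * (2 * (1 - x * 1) - (1 + y - x ^+ 2 * z - A) * (1 - x * 1 + x * z)) = 2 ->
    z * T = y * ((1 - x * 1 + x * z) * D) + (z - 1) * (y * Y) ->
  T%:F = (y%:F * (x%:F ^+ 3 * z%:F ^+ 2 - x%:F ^+ 3 * z%:F + x%:F ^+ 2 * z%:F
              + x%:F * y%:F * z%:F - x%:F * y%:F
              - 3 * x%:F * z%:F + x%:F + y%:F - 1
              + (x%:F * z%:F - x%:F + 1) * A%:F))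
        / ((x%:F ^+ 3 * z%:F ^+ 2 - x%:F ^+ 3 * z%:F + x%:F ^+ 2 * z%:F
            - x%:F * y%:F * z%:F + x%:F * y%:F
            - x%:F * z%:F - x%:F - y%:F + 1
            + (x%:F * z%:F - x%:F + 1) * A%:F) * (- 1 + y%:F) * z%:F)
        + y%:F / (1 - y%:F).
Proof.
rewrite -tofrac_eq0 => z0 DE /(fraction_system two0 yY DE).
rewrite tofrac1 => -[E [EE E0 y1 zT]].
apply: (mulfI z0); rewrite zT partial_fractions //.
congr (_ * (_ * _ / (_ * _ * _) + _)); rewrite EE; ring.
Qed.

End FractionForms.

(* The equalities hold in the field of fractions of Q[[x,y,z]]: the
   denominator of the third one is not invertible as a power series. *)
Theorem theorem2p9 :
  let x : {fraction Qxyz} := tofrac ps_x in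
  let y : {fraction Qxyz} := tofrac ps_y in
  let z : {fraction Qxyz} := tofrac ps_z in
  let F (p : rel nat) : {fraction Qxyz} := tofrac (faro_gf p) in
  let A1 : {fraction Qxyz} := tofrac (ps_sqrt
    (ps_x ^+ 4 - 2 * ps_x ^+ 2 * ps_y - 2 * ps_x ^+ 2
       + ps_y ^+ 2 - 2 * ps_y + 1)) in
  let A2 : {fraction Qxyz} := tofrac (ps_sqrt
    (ps_x ^+ 4 * ps_z ^+ 2 - 2 * ps_x ^+ 2 * ps_y * ps_z
       - 2 * ps_x ^+ 2 * ps_z + ps_y ^+ 2 - 2 * ps_y + 1)) in
  [/\ F pat11 =
        (2 * y * (x * z - x - 1))
        / (- (x * y * z) + x * y + x ^+ 3 * z - x ^+ 3 + y - x ^+ 2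
           + x * z + x - 1 + (x * z - x - 1) * A1),
      F pat21 = (2 * y) / (- y + x ^+ 2 * z - 2 * x + 1 + A2)
    & F pat12 =
        (y * (x ^+ 3 * z ^+ 2 - x ^+ 3 * z + x ^+ 2 * z + x * y * z - x * y
              - 3 * x * z + x + y - 1 + (x * z - x + 1) * A2))
        / ((x ^+ 3 * z ^+ 2 - x ^+ 3 * z + x ^+ 2 * z - x * y * z + x * y
            - x * z - x - y + 1 + (x * z - x + 1) * A2) * (- 1 + y) * z)
        + y / (1 - y)].
Proof.
move=> x y z F A1 A2.
have two0 : (2 : Qxyz) != 0.
  have: (2 : Qxyz) \is a GRing.unit by [].
  by apply: contraTneq => ->; rewrite unitr0.
have z0 : ps_z != 0.
  apply/eqP => /(congr1 (fun f : Qxyz => f 0%N 0%N 1%N)).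
  by move/eqP; rewrite oner_eq0.
have one : fpsC (fpsC 1) = 1 :> Qxyz by exact: erefl.
have zE : fpsC (fpsC fpsX) = ps_z by exact: erefl.
split.
- have wtE i j : pair_weight 1 fpsX 1 i j =
      if pat11 i j then fpsX else 1 :> {fps rat}.
    by rewrite /pair_weight /pat11; case: ltngtP.
  have [|D [Y [yY DE TE]]] := @faro_gf_system _ _ _ _ _ 1 ps_z 1
      (ps_x ^+ 4 - 2 * ps_x ^+ 2 * ps_y - 2 * ps_x ^+ 2
         + ps_y ^+ 2 - 2 * ps_y + 1) wtE one zE (mulr1 1) one.
    by ring.
  exact: (fraction_form11 two0 yY DE TE).
- have wtE i j : pair_weight 1 1 fpsX i j =
      if pat21 i j then fpsX else 1 :> {fps rat}.
    by rewrite /pair_weight /pat21; case: ltngtP.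
  have [|D [Y [yY DE TE]]] := @faro_gf_system _ _ _ _ _ 1 1 ps_z
      (ps_x ^+ 4 * ps_z ^+ 2 - 2 * ps_x ^+ 2 * ps_y * ps_z
       - 2 * ps_x ^+ 2 * ps_z + ps_y ^+ 2 - 2 * ps_y + 1)
      wtE one one (mul1r _) zE.
    by ring.
  exact: (fraction_form21 two0 yY DE TE).
have wtE i j : pair_weight fpsX 1 1 i j =
      if pat12 i j then fpsX else 1 :> {fps rat}.
  by rewrite /pair_weight /pat12; case: ltngtP.
have [|D [Y [yY DE TE]]] := @faro_gf_system _ _ _ _ _ ps_z 1 ps_z
    (ps_x ^+ 4 * ps_z ^+ 2 - 2 * ps_x ^+ 2 * ps_y * ps_z
     - 2 * ps_x ^+ 2 * ps_z + ps_y ^+ 2 - 2 * ps_y + 1)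
    wtE zE one (mulr1 _) zE.
  by ring.
exact: (fraction_form12 two0 yY z0 DE TE).
Qed.
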